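(* Let $(G,H)$ denote a pair consisting of a profinite group and a (closed) subgroup. Suppose a property $\mathcal Q$ of such pairs satisfies the following conditions: (a) If $\mathcal Q(G,H)$ and $K$ is a (closed) subgroup of $G$, then $\mathcal Q(K,H\cap K)$. (b) If $\mathcal Q(G,H)$ and $\pi$ is a (continuous) homomorphism on $G$, then $\mathcal Q(\pi(G),\pi(H))$. (c) If $\mathcal Q(G,H)$ and $\mathcal Q(G,K)$, then $\mathcal Q(G,HK)$. (d) If $(H_i)_{i\in\mathcal I}$ is an ascending chain of subgroups of $G$ such that $\mathcal Q(G,H_i)$ for all $i\in\mathcal I$, then $\mathcal Q\left(G,\overline{\bigcup_i H_i}\right)$. If $G$ is a fractal group, then the property $\mathcal P(H)=\mathcal Q(G,H)$ of closed subgroups $H$ of $G$ is self-similar. Also, if $\mathcal Q(G,H)$ implies that $H$ is open in $G$, then (d) is unnecessary.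
   Context: Let $T$ be the infinite $d$-regular rooted tree, with path data: a labeling of the vertices at level one by $0,\dots,d-1$ and, for each such vertex $i$, a rooted tree isomorphism $\lambda_i:T_i\to T$, where $T_v$ denotes the subtree over a vertex $v$. For each vertex $v$ there is a unique composition $\lambda_v:T_v\to T$ of the $\lambda_i$'s taking $v$ to the root. For a subgroup $H\le\mathrm{Aut}\,T$, $H_v$ is the stabilizer of $v$ in $H$, $\pi_v(h)=\lambda_v\circ h|_{T_v}\circ\lambda_v^{-1}$ for $h\in H_v$, and $H^v=\pi_v(H_v)$. A closed subgroup $G\le\mathrm{Aut}\,T$ is self-similar if $G^v\subseteq G$ for every vertex $v$, and fractal if $G^v=G$ for every vertex $v$. The self-similar closure of a closed subgroup $H\le G$ is the smallest closed self-similar subgroup of $G$ containing $H$. A property $\mathcal P$ of closed subgroups of $G$ is self-similar if whenever $H$ satisfies $\mathcal P$, so does the self-similar closure of $H$. The compositum $HK$ of two closed subgroups is the closed subgroup they generate; the bar denotes topological closure. *)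

(* Defs.v *)
From HB Require Import structures.
From mathcomp Require Import all_boot all_order monoid.
From mathcomp Require Import mathcomp_extra boolp classical_sets functions.
From mathcomp Require Import cardinality topology.

Set Implicit Arguments.
Unset Strict Implicit.
Unset Printing Implicit Defensive.

Import Algebra.

Local Obligation Tactic := idtac.

Local Open Scope group_scope.
Local Open Scope classical_set_scope.

Section initial_topology_facts.
Context (S : choiceType) (T : topologicalType) (f : S -> T).
Let W : topologicalType := initial_topology f.

Lemma initial_compact : compact (range f) -> compact [set: W].
Proof.
move=> cf F PF _; have [|y [[s _ <-] cls]] := cf (f @ F).
  by apply: (@filterS _ F _ setT) filterT => s _; exists s.
exists s; split=> // A B FA [_ [[C oC <-] Cs] sCB].
have [|t [[a Aa <-] Ca]] := cls (f @` A) C _ (open_nbhs_nbhs (conj oC Cs)).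
  by apply: (@filterS _ F _ A) FA => a Aa; exists a.
by exists a; split=> //; exact: sCB.
Qed.

Lemma initial_hausdorff : injective f -> hausdorff_space T -> hausdorff_space W.
Proof.
move=> fI hT p q clpq; apply: fI; apply: hT => A B nA nB.
have [r [Ar Br]] := clpq (f @^-1` A) (f @^-1` B)
  (@initial_continuous S T f p _ nA) (@initial_continuous S T f q _ nB).
by exists (f r).
Qed.

Lemma initial_totally_disconnected : injective f ->
  totally_disconnected [set: T] -> totally_disconnected [set: W].
Proof.
move=> fI tdT x _; rewrite eqEsubset; split; last first.
  by move=> ? ->; exact: connected_component_refl.
move=> z [C [Cx _ cC Cz]] /=; apply: fI.
suff : connected_component [set: T] (f x) (f z) by rewrite (tdT _ I).
exists (f @` C); last by exists z.
split=> //.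
apply: connected_continuous_connected cC _.
by apply: continuous_subspaceT; exact: initial_continuous.
Qed.

Lemma into_initial_continuous (U : topologicalType) (g : U -> W) :
  continuous (f \o g : U -> T) -> continuous g.
Proof.
move=> cg; apply/continuousP => _ [B oB <-].
by move/continuousP: cg => /(_ _ oB).
Qed.

End initial_topology_facts.

HB.mixin Record isProfiniteGroup G of Group G & Topological G := {
  mulg_continuous : continuous (fun x : G * G => x.1 * x.2);
  invg_continuous : continuous (fun x : G => x^-1);
  profinite_compact : compact [set: G];
  profinite_hausdorff : hausdorff_space G;
  profinite_totally_disconnected : totally_disconnected [set: G] }.

#[short(type="profiniteGroupType")]
HB.structure Definition ProfiniteGroup :=
  {G of Group G & Topological G & isProfiniteGroup G}.

Record closedSubgroup (G : profiniteGroupType) := ClosedSubgroup {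
  csg_set :> set G;
  csg_closed : closed csg_set;
  csg1 : csg_set 1;
  csgM : forall x y, csg_set x -> csg_set y -> csg_set (x * y);
  csgV : forall x, csg_set x -> csg_set x^-1 }.

Lemma csg_eq (G : profiniteGroupType) (H K : closedSubgroup G) :
  (H : set G) = (K : set G) -> H = K.
Proof.
case: H K => [H c1 c2 c3 c4] [K k1 k2 k3 k4] /= HK; case: _ / HK k1 k2 k3 k4.
by move=> *; congr ClosedSubgroup; exact: Prop_irrelevance.
Qed.

Section closed_subgroup_as_profinite_group.
Context (G : profiniteGroupType) (K : closedSubgroup G).

Let one_K : K := exist _ 1 (mem_set (csg1 K)).
Let mul_K (x y : K) : K :=
  exist _ (val x * val y) (mem_set (csgM (set_valP x) (set_valP y))).
Let inv_K (x : K) : K := exist _ (val x)^-1 (mem_set (csgV (set_valP x))).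

Let mulA_K : associative mul_K.
Proof. by move=> x y z; apply: val_inj; rewrite /= mulgA. Qed.
Let mul1_K : left_id one_K mul_K.
Proof. by move=> x; apply: val_inj; rewrite /= mul1g. Qed.
Let mulK1 : right_id one_K mul_K.
Proof. by move=> x; apply: val_inj; rewrite /= mulg1. Qed.
Let mulV_K : left_inverse one_K inv_K mul_K.
Proof. by move=> x; apply: val_inj; rewrite /= mulVg. Qed.
Let mulKV : right_inverse one_K inv_K mul_K.
Proof. by move=> x; apply: val_inj; rewrite /= mulgV. Qed.

HB.instance Definition _ :=
  isGroup.Build (set_type K) mulA_K mul1_K mulK1 mulV_K mulKV.

Let val_cont : continuous (set_val : set_type K -> G).
Proof. exact: initial_continuous. Qed.

Let mul_cont : continuous (fun x : set_type K * set_type K => x.1 * x.2).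
Proof.
apply: into_initial_continuous => x.
apply: (@continuous_comp _ _ _
  (fun x : set_type K * set_type K => (set_val x.1, set_val x.2))
  (fun x : G * G => x.1 * x.2)); last exact: mulg_continuous.
by apply: cvg_pair; apply: (continuous_comp _ (@val_cont _));
  [exact: cvg_fst|exact: cvg_snd].
Qed.

Let inv_cont : continuous (fun x : set_type K => x^-1).
Proof.
apply: into_initial_continuous => x.
by apply: (@continuous_comp _ _ _ (set_val : set_type K -> G)
  (fun x : G => x^-1)); [exact: val_cont|exact: invg_continuous].
Qed.

Let compact_K : compact [set: set_type K].
Proof.
apply: initial_compact.
rewrite (_ : range _ = [set: G] `&` K).
  by apply: compact_closedI; [exact: profinite_compact|exact: csg_closed].
rewrite eqEsubset; split=> [_ [x _ <-]|x [_ Kx]]; first by split; [|exact: set_valP].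
by exists (exist _ x (mem_set Kx)).
Qed.

Let hausdorff_K : hausdorff_space (set_type K).
Proof. by apply: initial_hausdorff; [exact: val_inj|exact: profinite_hausdorff]. Qed.

Let totdisc_K : totally_disconnected [set: set_type K].
Proof.
apply: initial_totally_disconnected; first exact: val_inj.
exact: profinite_totally_disconnected.
Qed.

HB.instance Definition _ := isProfiniteGroup.Build (set_type K)
  mul_cont inv_cont compact_K hausdorff_K totdisc_K.

End closed_subgroup_as_profinite_group.

Definition subgroup_group (G : profiniteGroupType) (K : closedSubgroup G) :
  profiniteGroupType := set_type K.

Section closed_subgroup_operations.
Context (G : profiniteGroupType).
Implicit Types (H K : closedSubgroup G).

Program Definition csgT : closedSubgroup G := @ClosedSubgroup G setT _ _ _ _.
Next Obligation. exact: closedT. Qed.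
Next Obligation. by []. Qed.
Next Obligation. by []. Qed.
Next Obligation. by []. Qed.

(* H `&` K, as a closed subgroup of the profinite group K. *)
Program Definition csgI_in K H : closedSubgroup (subgroup_group K) :=
  @ClosedSubgroup (subgroup_group K) (set_val @^-1` H) _ _ _ _.
Next Obligation.
move=> K H; apply: preimage_closed; last exact: csg_closed.
by move=> x _; exact: (@initial_continuous _ _ (set_val : K -> G) x).
Qed.
Next Obligation. by move=> K H; exact: csg1. Qed.
Next Obligation. by move=> K H x y; exact: csgM. Qed.
Next Obligation. by move=> K H x; exact: csgV. Qed.

Program Definition csg_bigcap (F : set (closedSubgroup G)) : closedSubgroup G :=
  @ClosedSubgroup G (\bigcap_(L in F) (L : set G)) _ _ _ _.
Next Obligation. by move=> F; apply: closed_bigI => L _; exact: csg_closed. Qed.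
Next Obligation. by move=> F L _; exact: csg1. Qed.
Next Obligation. by move=> F x y Fx Fy L FL; apply: csgM; [exact: Fx|exact: Fy]. Qed.
Next Obligation. by move=> F x Fx L FL; apply: csgV; exact: Fx. Qed.

Definition compositum H K : closedSubgroup G :=
  csg_bigcap [set L | H `|` K `<=` (L : set G)].

End closed_subgroup_operations.

Program Definition csg_image (G G' : profiniteGroupType)
    (f : {multiplicative G -> G'}) (cf : continuous f) (H : closedSubgroup G) :
  closedSubgroup G' := @ClosedSubgroup G' (f @` H) _ _ _ _.
Next Obligation.
move=> G G' f cf H; apply: compact_closed; first exact: profinite_hausdorff.
apply: continuous_compact; first exact: continuous_subspaceT.
rewrite -[X in compact X]setTI.
by apply: compact_closedI; [exact: profinite_compact|exact: csg_closed].
Qed.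
Next Obligation.
move=> G G' f cf H; exists 1; first exact: csg1.
by apply: (@mulgI _ (f 1)); rewrite mulg1 -gmulfM mulg1.
Qed.
Next Obligation.
move=> G G' f cf H _ _ [x Hx <-] [y Hy <-].
by exists (x * y); [exact: csgM|exact: gmulfM].
Qed.
Next Obligation.
move=> G G' f cf H _ [x Hx <-]; exists x^-1; first exact: csgV.
have f1 : f 1 = 1 by apply: (@mulgI _ (f 1)); rewrite mulg1 -gmulfM mulg1.
by apply: (@mulgI _ (f x)); rewrite mulgV -gmulfM mulgV.
Qed.

Section regular_tree.
Context (d : nat).

Definition tree : Type := seq 'I_d.
HB.instance Definition _ := Choice.on tree.

Implicit Types u v w x y : tree.

(* w is a child of v *)
Definition edge v w : bool := [exists i : 'I_d, w == rcons v i].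

Definition subtree v : set tree := [set w | prefix v w].

Lemma subtree_root x : subtree [::] x.
Proof. exact: prefix0s. Qed.
#[local] Hint Resolve subtree_root : core.

(* f restricts to an isomorphism of rooted trees subtree u -> subtree v; the
   values of f outside subtree u are irrelevant. *)
Definition rooted_iso u v (f : tree -> tree) : Prop :=
  [/\ set_bij (subtree u) (subtree v) f, f u = v &
      forall x y, subtree u x -> subtree u y -> edge (f x) (f y) = edge x y].

Lemma edgeP v w : reflect (exists i, w = rcons v i) (edge v w).
Proof.
by apply: (iffP existsP) => [[i /eqP ->]|[i ->]]; exists i.
Qed.

Lemma edge_size v w : edge v w -> size w = (size v).+1.
Proof. by move=> /edgeP[i ->]; rewrite size_rcons. Qed.

Lemma edge_prefix v w : edge v w -> prefix v w.
Proof. by move=> /edgeP[i ->]; exact: prefix_rcons. Qed.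

Lemma edge_rcons v i : edge v (rcons v i).
Proof. by apply/edgeP; exists i. Qed.

Lemma rooted_iso_sub u v f x : rooted_iso u v f -> subtree u x -> subtree v (f x).
Proof. by move=> [[fuv _ _] _ _] ux; exact: fuv. Qed.

Lemma rooted_iso_prefix u v f x y : rooted_iso u v f ->
  subtree u x -> subtree u y -> prefix (f x) (f y) = prefix x y.
Proof.
move=> [[fuv finj fsurj] fu fe] ux uy; apply/idP/idP.
- move=> /prefixP[s]; elim/last_ind: s => [|s i IHs] in y uy *.
    by rewrite cats0 => /(finj _ _ (mem_set uy) (mem_set ux)) ->; exact: prefix_refl.
  rewrite -rcons_cat => fy.
  have [y' uy' fy'] : exists2 y', subtree u y' & f y' = f x ++ s.
    have : subtree v (f x ++ s).
      by apply: (@prefix_trans _ (f x)); [exact: fuv|exact: prefix_prefix].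
    by move=> /fsurj[y' ? ?]; exists y'.
  apply: (prefix_trans (IHs y' uy' fy')); apply: edge_prefix.
  by rewrite -fe // fy fy' edge_rcons.
- move=> /prefixP[s]; elim/last_ind: s => [|s i IHs] in y uy *.
    by rewrite cats0 => ->; exact: prefix_refl.
  rewrite -rcons_cat => yE.
  have uxs : subtree u (x ++ s).
    by apply: (@prefix_trans _ x); [exact: ux|exact: prefix_prefix].
  apply: (prefix_trans (IHs _ uxs erefl)); apply: edge_prefix.
  by rewrite fe // yE edge_rcons.
Qed.

Lemma rooted_iso_size u v f x : rooted_iso u v f -> subtree u x ->
  (size (f x) + size u = size x + size v)%N.
Proof.
move=> fP /prefixP[s ->]; have [_ fu fe] := fP.
elim/last_ind: s => [|s i IHs]; first by rewrite cats0 fu addnC.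
have us : subtree u (u ++ s) by exact: prefix_prefix.
have us' : subtree u (u ++ rcons s i) by exact: prefix_prefix.
have /edge_size-> : edge (f (u ++ s)) (f (u ++ rcons s i)).
  by rewrite fe // -rcons_cat edge_rcons.
by rewrite addSn IHs -rcons_cat size_rcons addSn.
Qed.

Lemma rooted_iso_id u : rooted_iso u u id.
Proof.
by split=> //; split=> // x ux; exists x.
Qed.

Lemma rooted_iso_comp u v w f g :
  rooted_iso u v f -> rooted_iso v w g -> rooted_iso u w (g \o f).
Proof.
move=> fP gP; have [fb fu fe] := fP; have [gb gv ge] := gP.
split; first exact: set_bij_comp fb gb.
  by rewrite /= fu gv.
move=> x y ux uy; rewrite /= ge ?fe //; exact: rooted_iso_sub fP _.
Qed.

Lemma rooted_iso_restrict u v f x :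
  rooted_iso u v f -> subtree u x -> rooted_iso x (f x) f.
Proof.
move=> fP ux; have [[fuv finj fsurj] fu fe] := fP.
have sxu y : subtree x y -> subtree u y by exact: prefix_trans.
split=> [|//|y z /sxu uy /sxu uz]; last exact: fe.
split=> [y xy|y z /set_mem/sxu uy /set_mem/sxu uz|z fxz].
- by rewrite /subtree /= (rooted_iso_prefix fP) //; exact: sxu.
- by apply: finj; exact/mem_set.
- have /fsurj[y uy yz] : subtree v z.
    by apply: prefix_trans fxz; exact: fuv.
  by exists y => //; rewrite /subtree /= -(rooted_iso_prefix fP) // yz.
Qed.

Lemma rooted_iso_inv u v f :
  rooted_iso u v f -> rooted_iso v u ('pinv_(fun=> u) (subtree u) f).
Proof.
move=> fP; have [fb fu fe] := fP; have [fuv finj fsurj] := fb.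
set g := 'pinv_ _ _ _.
have gb : set_bij (subtree v) (subtree u) g by exact: bijpinv_bij.
have gK : {in subtree v, cancel g f} by exact: surjpK.
have Kg : {in subtree u, cancel f g} by exact: pinvKV.
split=> // [|x y vx vy].
  by rewrite -[in LHS]fu Kg //; apply: mem_set; exact: prefix_refl.
have [guv _ _] := gb.
by rewrite -fe ?gK //; [exact: mem_set|exact: mem_set|exact: guv|exact: guv].
Qed.

Record aut := Aut {
  aut_fun :> tree -> tree;
  autP : rooted_iso [::] [::] aut_fun }.

HB.instance Definition _ := gen_eqMixin aut.
HB.instance Definition _ := gen_choiceMixin aut.

Lemma aut_eq (f g : aut) : f =1 g -> f = g.
Proof.
case: f g => [f fP] [g gP] /= /funext fg; case: _ / fg gP => gP.
by congr Aut; exact: Prop_irrelevance.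
Qed.

Definition aut_one : aut := Aut (rooted_iso_id [::]).
Definition aut_mul (f g : aut) : aut := Aut (rooted_iso_comp (autP g) (autP f)).
Definition aut_inv (f : aut) : aut := Aut (rooted_iso_inv (autP f)).

Lemma aut_bij (f : aut) : set_bij (subtree [::]) (subtree [::]) f.
Proof. by have [] := autP f. Qed.

Lemma aut_invK (f : aut) : cancel (aut_inv f) f.
Proof.
have [_ _ fsurj] := aut_bij f => x.
by apply: (surjpK _ fsurj); exact: mem_set.
Qed.

Lemma aut_funK (f : aut) : cancel f (aut_inv f).
Proof.
have [_ finj _] := aut_bij f => x.
by apply: (pinvKV _ finj); exact: mem_set.
Qed.

Lemma aut_size (f : aut) x : size (f x) = size x.
Proof. by have := @rooted_iso_size _ _ _ x (autP f) (subtree_root x); rewrite !addn0. Qed.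

Let aut_mulA : associative aut_mul. Proof. by move=> *; exact: aut_eq. Qed.
Let aut_mul1g : left_id aut_one aut_mul. Proof. by move=> *; exact: aut_eq. Qed.
Let aut_mulg1 : right_id aut_one aut_mul. Proof. by move=> *; exact: aut_eq. Qed.
Let aut_mulVg : left_inverse aut_one aut_inv aut_mul.
Proof. by move=> f; apply: aut_eq => x; exact: aut_funK. Qed.
Let aut_mulgV : right_inverse aut_one aut_inv aut_mul.
Proof. by move=> f; apply: aut_eq => x; exact: aut_invK. Qed.

HB.instance Definition _ :=
  isGroup.Build aut aut_mulA aut_mul1g aut_mulg1 aut_mulVg aut_mulgV.

Definition aut_ptws (f : aut) : {ptws tree -> discrete_topology tree} := f.

HB.instance Definition _ := Topological.copy aut (initial_topology aut_ptws).

Lemma aut_continuous (U : topologicalType) (g : U -> aut) :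
  (forall (u0 : U) (x : tree), \forall u \near u0, g u x = g u0 x) ->
  continuous g.
Proof.
move=> gx; apply: into_initial_continuous => u0; apply/cvg_sup => x.
apply: (@into_initial_continuous _ _
  (fun f : {ptws tree -> discrete_topology tree} => f x))  => {}u0.
apply/(@discrete_cvg (discrete_topology tree)).
exact: gx.
Qed.

Lemma aut_near (f0 : aut) (x : tree) : \forall f \near f0, (f : aut) x = f0 x.
Proof.
have : {for f0, continuous (fun f : aut => aut_ptws f x : discrete_topology tree)}.
  apply: (@continuous_comp _ _ _ aut_ptws
    (fun f : {ptws tree -> discrete_topology tree} => f x)).
    exact: initial_continuous.
  exact: (@proj_continuous tree (fun=> discrete_topology tree)).
move=> /(@discrete_cvg (discrete_topology tree)) f0x.
by apply: f0x; exact: (fmap_filter _ (nbhs_filter f0)).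
Qed.

Let aut_mul_continuous : continuous (fun f : aut * aut => f.1 * f.2).
Proof.
apply: aut_continuous => -[f g] x.
exists ([set f' : aut | f' (g x) = f (g x)], [set g' : aut | g' x = g x]).
  by split; exact: aut_near.
by move=> [f' g'] /= [ff' gg']; rewrite -[LHS]/(f' (g' x)) gg' ff'.
Qed.

Let aut_inv_continuous : continuous (fun f : aut => f^-1).
Proof.
apply: aut_continuous => f x.
apply: filterS (aut_near f (aut_inv f x)) => g.
rewrite /= aut_invK => gx.
by transitivity (aut_inv g (g (aut_inv f x))); [rewrite gx|exact: aut_funK].
Qed.

Let aut_ptws_inj : injective aut_ptws.
Proof. by move=> f g fg; apply: aut_eq => x; rewrite -[f x]/(aut_ptws f x) fg. Qed.

Let aut_hausdorff : hausdorff_space aut.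
Proof.
apply: initial_hausdorff => //.
apply: (@hausdorff_product _ (fun=> discrete_topology tree)) => _.
exact: discrete_hausdorff.
Qed.

Let aut_totally_disconnected : totally_disconnected [set: aut].
Proof.
apply: initial_totally_disconnected => //.
apply: zero_dimension_totally_disconnected.
apply: (@zero_dimension_prod tree (fun=> discrete_topology tree)) => _.
exact: discrete_zero_dimension.
Qed.

Let ptws_closed2 (R : tree -> tree -> Prop) x y :
  closed [set f : {ptws tree -> discrete_topology tree} | R (f x) (f y)].
Proof.
rewrite (_ : mkset _ = \bigcap_(a in [set: tree])
  ((proj x @^-1` [set b | b <> a]) `|` (proj y @^-1` [set b | R a b]))).
  apply: closed_bigI => a _; apply: closedU; apply: preimage_closed;
    by [exact: discrete_closed|move=> z _;
        exact: (@proj_continuous tree (fun=> discrete_topology tree))].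
rewrite eqEsubset; split=> f /=.
  move=> Rf a _; have [fxa|] := pselect (f x = a); last by left.
  by right; rewrite /= -fxa.
by move=> /(_ (f x) I)[].
Qed.

Let range_autE : range aut_ptws =
  [set f : {ptws tree -> discrete_topology tree} |
    forall x, size (f x : tree) = size x] `&`
  \bigcap_(xy in [set: tree * tree])
    [set f : {ptws tree -> discrete_topology tree} |
       edge (f xy.1) (f xy.2) = edge xy.1 xy.2 /\ (f xy.1 = f xy.2 -> xy.1 = xy.2)].
Proof.
rewrite eqEsubset; split=> [_ [f _ <-]|f [fs fP]].
  split=> [x|[x y] _]; first exact: aut_size.
  split; first by have [_ _ ->] := autP f.
  exact: (can_inj (aut_funK f)).
have finj : injective (f : tree -> tree) by move=> x y; exact: (fP (x, y) I).2.
have f0 : f [::] = [::] by apply: size0nil; rewrite fs.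
have fiso : rooted_iso [::] [::] f.
  split=> // [|x y _ _]; last exact: (fP (x, y) I).1.
  split=> // [x y _ _ /finj //|x _].
  pose h (t : (size x).-tuple 'I_d) : (size x).-tuple 'I_d :=
    tcast (etrans (fs t) (size_tuple t)) (in_tuple (f t)).
  have hE t : h t = f t :> seq _ by rewrite /h val_tcast.
  have hinj : injective h.
    by move=> s t st; apply: val_inj; apply: finj; rewrite -!hE st.
  have [g _ gh] := injF_bij hinj.
  by exists (g (in_tuple x)) => //; rewrite -hE gh.
by exists (Aut fiso).
Qed.

Let aut_compact : compact [set: aut].
Proof.
apply: initial_compact; rewrite range_autE; apply: compact_closedI.
  apply: (@tychonoff tree (fun=> discrete_topology tree)
    (fun x => [set y : tree | size y = size x])) => x.
  apply: finite_compact.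
  apply: (@sub_finite_set _ _ (range (fun t : (size x).-tuple 'I_d => val t))).
    by move=> y /= <-; exists (in_tuple y).
  by apply: finite_image; exact: finite_finset.
apply: closed_bigI => -[x y] _.
exact: (@ptws_closed2 (fun a b => edge a b = edge x y /\ (a = b -> x = y)) x y).
Qed.

HB.instance Definition _ := isProfiniteGroup.Build aut aut_mul_continuous
  aut_inv_continuous aut_compact aut_hausdorff aut_totally_disconnected.

End regular_tree.

(* The vertices at level one are the one-letter words; [:: i] is labeled i. *)
Record path_data d := PathData {
  lam : 'I_d -> tree d -> tree d;
  lamP : forall i, rooted_iso [:: i] [::] (lam i) }.

Section self_similarity.
Context (d : nat) (L : path_data d).
Implicit Types (v w : tree d) (G H K : closedSubgroup (aut d)).

Fixpoint lam_comp n v : tree d -> tree d :=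
  match n, v with
  | n'.+1, i :: _ => lam_comp n' (lam L i v) \o lam L i
  | _, _ => id
  end.

(* The isomorphism subtree v -> T obtained by composing size v of the lam i:
   for v below [:: i], apply lam i, and continue from lam i v. *)
Definition lam_at v : tree d -> tree d := lam_comp (size v) v.

Lemma lam_at_iso v : rooted_iso v [::] (lam_at v).
Proof.
rewrite /lam_at; move sv: (size v) => n.
elim: n => [|n IHn] in v sv *; first by rewrite (size0nil sv); exact: rooted_iso_id.
case: v sv => [//|i v] /= [sv].
have iv : subtree [:: i] (i :: v) by rewrite /subtree /= eqxx prefix0s.
apply: (rooted_iso_comp (rooted_iso_restrict (lamP L i) iv)); apply: IHn.
have := rooted_iso_size (lamP L i) iv.
by rewrite /= addn0 addn1 => -[->].
Qed.

Lemma pi_at_iso v (h : aut d) : h v = v ->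
  rooted_iso [::] [::]
    (lam_at v \o h \o 'pinv_(fun=> v) (subtree v) (lam_at v)).
Proof.
move=> hv; apply: rooted_iso_comp (rooted_iso_inv (lam_at_iso v)) _.
apply: rooted_iso_comp (lam_at_iso v).
by rewrite -[X in rooted_iso _ X]hv; apply: rooted_iso_restrict (autP h) _; exact: prefix0s.
Qed.

Definition pi_at v (h : aut d) (hv : h v = v) : aut d := Aut (pi_at_iso hv).

Definition section_group v H : set (aut d) :=
  [set g | exists (h : aut d) (hv : h v = v), (H : set (aut d)) h /\ g = pi_at hv].

Definition self_similar G : Prop :=
  forall v, section_group v G `<=` (G : set (aut d)).

Definition fractal G : Prop :=
  forall v, section_group v G = (G : set (aut d)).

Definition self_similar_closure G H : closedSubgroup (aut d) :=
  csg_bigcap [set K | [/\ self_similar K, (H : set (aut d)) `<=` K &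
                          (K : set (aut d)) `<=` G]].

Lemma self_similar_closureP G H (K := self_similar_closure G H) :
  self_similar G -> (H : set (aut d)) `<=` G ->
  [/\ self_similar K, (H : set (aut d)) `<=` K, (K : set (aut d)) `<=` G &
      forall K', self_similar K' -> (H : set (aut d)) `<=` K' ->
        (K' : set (aut d)) `<=` G -> (K : set (aut d)) `<=` K'].
Proof.
move=> ssG HG; split=> [v _ [h [hv [Kh ->]]] M [ssM HM MG]|x Hx M [_ HM _]|x Kx|].
- by apply: (ssM v); exists h, hv; split=> //; exact: Kh.
- exact: HM.
- by apply: Kx; split.
- by move=> K' ssK' HK' K'G x; apply; split.
Qed.

(* Closed subgroups of the profinite group G are the csgI_in G H, for H a closed
   subgroup of aut d contained in G. *)
Definition self_similar_property G
    (R : closedSubgroup (subgroup_group G) -> Prop) : Prop :=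
  forall H, (H : set (aut d)) `<=` G ->
    R (csgI_in G H) -> R (csgI_in G (self_similar_closure G H)).

End self_similarity.

Section pair_properties.
Variable Q : forall G : profiniteGroupType, closedSubgroup G -> Prop.

Definition subgroup_stable : Prop :=
  forall (G : profiniteGroupType) (H K : closedSubgroup G),
    Q H -> Q (csgI_in K H).

(* csgI_in views f(H), contained in f(G), as a subgroup of the group f(G). *)
Definition image_stable : Prop :=
  forall (G G' : profiniteGroupType) (f : {multiplicative G -> G'})
    (cf : continuous f) (H : closedSubgroup G),
    Q H -> Q (csgI_in (csg_image cf (csgT G)) (csg_image cf H)).

Definition compositum_stable : Prop :=
  forall (G : profiniteGroupType) (H K : closedSubgroup G),
    Q H -> Q K -> Q (compositum H K).

Definition chain_stable : Prop :=
  forall (G : profiniteGroupType) (disp : Order.disp_t) (I : orderType disp)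
    (i0 : I) (H : I -> closedSubgroup G),
    (forall i j, (i <= j)%O -> (H i : set G) `<=` H j) ->
    (forall i, Q (H i)) ->
    forall K : closedSubgroup G,
      (K : set G) = closure (\bigcup_i (H i : set G)) -> Q K.

Definition forces_open : Prop :=
  forall (G : profiniteGroupType) (H : closedSubgroup G),
    Q H -> open (H : set G).

End pair_properties.

(* Main.v *)
(* The map A |-> A^v preserves Q: restrict to the stabilizer of v by (a), then
   apply pi_v, which maps the stabilizer onto G by fractality, using (b).
   Starting from H, repeatedly adjoin to A_n finitely many A_n^v, reaching every v
   eventually. The union M of the A_n is then closed under sections, and so is its
   closure, because stabilizers are open and pi_v is continuous; hence the closure
   of M is the self-similar closure of H. (A single round of adjoining all H^v
   would not do: a product of elements of the H^v can fix a vertex that the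
   factors move.) If Q forces openness, compactness makes the chain stationary,
   so (d) is not needed. *)
Require Import Defs.
From HB Require Import structures.
From mathcomp Require Import all_boot all_order monoid.
From mathcomp Require Import boolp classical_sets functions.
From mathcomp Require Import topology.

Set Implicit Arguments.
Unset Strict Implicit.
Unset Printing Implicit Defensive.

Import Algebra.

Local Open Scope group_scope.
Local Open Scope classical_set_scope.

(** * Closures, joins and ascending unions of closed subgroups *)

Section closed_subgroups.
Context (G : profiniteGroupType).
Implicit Types (A B M : closedSubgroup G) (D : set G).

Lemma closure_csg D : D 1 -> (forall x y, D x -> D y -> D (x * y)) ->
    (forall x, D x -> D x^-1) ->
  exists A, (A : set G) = closure D.
Proof.
move=> D1 DM DV.
have cM x y : closure D x -> closure D y -> closure D (x * y).
  move=> Dx Dy N /(@mulg_continuous G (x, y))[[N1 N2] /= [xN1 yN2] NM].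
  have [a [Da Na]] := Dx _ xN1; have [b [Db Nb]] := Dy _ yN2.
  by exists (a * b); split; [exact: DM|exact: (NM (a, b))].
have cV x : closure D x -> closure D x^-1.
  move=> Dx N /(@invg_continuous G x) xN; have [a [Da Na]] := Dx _ xN.
  by exists a^-1; split => //; exact: DV.
by exists (ClosedSubgroup (@closed_closure _ D) (@subset_closure _ D _ D1) cM cV).
Qed.

Lemma compositum_subl A B : (A : set G) `<=` compositum A B.
Proof. by move=> x Ax M; apply; left. Qed.

Lemma compositum_subr A B : (B : set G) `<=` compositum A B.
Proof. by move=> x Bx M; apply; right. Qed.

Lemma compositum_min A B M : (A : set G) `<=` M -> (B : set G) `<=` M ->
  (compositum A B : set G) `<=` M.
Proof. by move=> AM BM x; apply=> y [/AM|/BM]. Qed.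

Lemma ascending_subset (A : nat -> closedSubgroup G) :
    (forall n, (A n : set G) `<=` A n.+1) ->
  forall m n, (m <= n)%N -> (A m : set G) `<=` A n.
Proof.
move=> AS m n; elim: n => [|n IHn]; first by rewrite leqn0 => /eqP->.
by rewrite leq_eqVlt => /predU1P[->//|/IHn Amn x /Amn/AS].
Qed.

Lemma closure_bigcup_csg (A : nat -> closedSubgroup G) :
    (forall n, (A n : set G) `<=` A n.+1) ->
  exists M, (M : set G) = closure (\bigcup_n (A n : set G)).
Proof.
move=> /ascending_subset AS; apply: closure_csg.
- by exists 0%N => //; exact: csg1.
- move=> x y [m _ Ax] [n _ Ay]; exists (maxn m n) => //; apply: csgM.
    exact: AS (leq_maxl _ _) _ Ax.
  exact: AS (leq_maxr _ _) _ Ay.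
- by move=> x [n _ Ax]; exists n => //; exact: csgV.
Qed.

(* An open subgroup is closed and so is the union, which is a union of cosets of
   [A 0]; hence it is compact. *)
Lemma open_ascending_stationary (A : nat -> closedSubgroup G) :
    (forall n, (A n : set G) `<=` A n.+1) -> (forall n, open (A n : set G)) ->
  exists n, (A n : set G) = closure (\bigcup_n (A n : set G)).
Proof.
move=> /ascending_subset AS oA; set D := \bigcup_n _.
have cD : closure D `<=` D.
  move=> x Dx.
  (* The coset of [A 0] through [x] is a neighbourhood of [x], so it meets some [A n]; as [A n]
     contains [A 0], it contains [x] too. *)
  have : \forall y \near x, (A 0%N : set G) (x^-1 * y).
    have cx : {for x, continuous (fun y : G => x^-1 * y)}.
      apply: (@continuous_comp _ _ _ (fun y : G => (x^-1, y))
        (fun z : G * G => z.1 * z.2)); last exact: mulg_continuous.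
      by apply: cvg_pair; [exact: cvg_cst|exact: cvg_id].
    apply: cx; rewrite mulVg; apply: open_nbhs_nbhs.
    by split; [exact: oA|exact: csg1].
  move=> /Dx[y [[n _ Ay] A0]]; exists n => //.
  have -> : x = y * (x^-1 * y)^-1 by rewrite invgM invgK mulgA mulgV mul1g.
  by apply: csgM => //; apply: csgV; exact: AS A0.
have : compact D.
  rewrite -[D]setTI; apply: compact_closedI; first exact: profinite_compact.
  exact: cD.
(* Each point of [D] has a neighbourhood lying in [A m] for all large [m]; by compactness one index
   serves all of [D]. *)
move=> /compact_near_coveringP/(_ nat \oo (fun n => (A n : set G)) _)[].
  move=> x [n _ Ax].
  exists ((A n : set G), [set m | (n <= m)%N]).
    split; first by apply: open_nbhs_nbhs; split; [exact: oA|].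
    by exists n.
  by move=> [y m] /= [Ay nm]; exact: AS nm _ Ay.
move=> n _ /(_ n (leqnn n)) DA; exists n; rewrite eqEsubset; split.
  by move=> x Ax; apply: subset_closure; exists n.
by move=> x /cD; exact: DA.
Qed.

Lemma subgroup_group_val A x : (A : set G) x ->
  exists y : subgroup_group A, val y = x.
Proof. by move=> Ax; exists (exist _ x (mem_set Ax)). Qed.

End closed_subgroups.

(** * Closing a subgroup under countably many operations *)

Section saturation.
Context (G : profiniteGroupType) (V : countType).
Variables (s : V -> closedSubgroup G -> closedSubgroup G) (A : closedSubgroup G).

(** Only the [v] decoded from numbers below [n] are treated, so a step is a finite iteration of
    binary composita, yet each [v] is treated at all but finitely many steps. *)
Definition saturation_step n (B : closedSubgroup G) : closedSubgroup G :=
  foldr (fun v => compositum (s v B)) B (pmap unpickle (iota 0 n)).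

Fixpoint saturation n : closedSubgroup G :=
  if n is n'.+1 then saturation_step n' (saturation n') else A.

Lemma saturation_subS n : (saturation n : set G) `<=` saturation n.+1.
Proof.
rewrite /= /saturation_step; elim: (pmap _ _) => [//|v r IHr] x Ax.
by apply: compositum_subr; exact: IHr.
Qed.

Lemma saturation_sub m n : (m <= n)%N -> (saturation m : set G) `<=` saturation n.
Proof. exact/ascending_subset/saturation_subS. Qed.

Lemma saturation_op v n : (pickle v < n)%N ->
  (s v (saturation n) : set G) `<=` saturation n.+1.
Proof.
move=> vn; rewrite /= /saturation_step.
have : v \in pmap unpickle (iota 0 n).
  by rewrite mem_pmap; apply/mapP; exists (pickle v); rewrite ?pickleK ?mem_iota.
elim: (pmap _ _) => [//|w r IHr]; rewrite inE => /predU1P[->|/IHr vr] x sx /=.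
  exact: compositum_subl.
by apply: compositum_subr; exact: vr.
Qed.

(** Used both to carry [Q] along the chain and to bound the chain from above by the self-similar
    closure. *)
Lemma saturation_ind (T : closedSubgroup G -> Prop) :
    (forall B C, T B -> T C -> T (compositum B C)) ->
    (forall v B, T B -> T (s v B)) -> T A ->
  forall n, T (saturation n).
Proof.
move=> TC Ts TA; elim=> [//|n IHn] /=; rewrite /saturation_step.
by elim: (pmap _ _) => [//|v r IHr] /=; apply: TC => //; exact: Ts.
Qed.

End saturation.

(** * The section map at a vertex of the tree *)

Section sections.
Context (d : nat) (L : path_data d).
Implicit Types (v : tree d) (g h : aut d).

(* Extended by 1 outside the stabilizer of v; since the stabilizer is clopen,
   the extension is continuous on the whole group. *)
Definition pi_total v h : aut d :=
  if pselect (h v = v) is left hv then pi_at L hv else 1.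

Lemma pi_totalE v h (hv : h v = v) : pi_total v h = pi_at L hv.
Proof.
rewrite /pi_total; case: pselect => // hv'.
by congr pi_at; exact: Prop_irrelevance.
Qed.

Lemma pi_total_nfix v h : h v <> v -> pi_total v h = 1.
Proof. by move=> hv; rewrite /pi_total; case: pselect. Qed.

Lemma pi_totalM v g h : g v = v -> h v = v ->
  pi_total v (g * h) = pi_total v g * pi_total v h.
Proof.
move=> gv hv; have ghv : (g * h) v = v by rewrite -[LHS]/(g (h v)) hv.
rewrite !pi_totalE; apply: aut_eq => x.
have lamv := lam_at_iso L v; have [[_ linj _] _ _] := lamv.
set l := lam_at L v; set l' := 'pinv_(fun=> v) (subtree v) l.
(* The inner [l'] after [l] cancels on the subtree over [v], and [h (l' x)] lies there because [h]
   fixes [v]. *)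
change (l (g (h (l' x))) = l (g (l' (l (h (l' x)))))).
congr (l (g _)); apply/esym/(pinvKV _ linj)/mem_set.
have l'x : subtree v (l' x).
  by apply: rooted_iso_sub (rooted_iso_inv lamv) _; exact: prefix0s.
by rewrite /subtree /= -[in X in prefix X _]hv (rooted_iso_prefix (autP h)) //;
  exact: prefix0s.
Qed.

Lemma pi_total_continuous v : continuous (pi_total v).
Proof.
apply: aut_continuous => h x.
have [hv|hv] := pselect (h v = v); last first.
  apply: filterS (aut_near h v) => g gv.
  by rewrite !pi_total_nfix // gv.
(* On the stabilizer of [v], the section sends [x] to a vertex determined by the value of [h] at [y]
   alone. *)
pose y := 'pinv_(fun=> v) (subtree v) (lam_at L v) x.
apply: filterS2 (aut_near h v) (aut_near h y) => g gv gy.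
have gv' : g v = v by rewrite gv.
by rewrite !pi_totalE; congr (lam_at L v _).
Qed.

Lemma section_groupE v (H : closedSubgroup (aut d)) :
  section_group L v H = pi_total v @` [set h | (H : set (aut d)) h /\ h v = v].
Proof.
rewrite eqEsubset; split=> [_ [h [hv [Hh ->]]]|_ [h [Hh hv] <-]].
  by exists h => //; exact: pi_totalE.
by exists h, hv; split => //; exact: pi_totalE.
Qed.

End sections.

(** * Sections of closed subgroups of a fixed group [G] *)

Section sections_in_subgroup.
Context (d : nat) (L : path_data d) (G : closedSubgroup (aut d)) (v : tree d).

Let fixv := [set g : subgroup_group G | (val g : aut d) v = v].

Let fixv_closed : closed fixv.
Proof.
rewrite (_ : fixv = (set_val : G -> aut d) @^-1` [set h | h v = v]) //.
apply: preimage_closed.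
  by move=> x _; exact: (@initial_continuous _ _ (set_val : G -> aut d) x).
move=> h /(_ _ (aut_near h v))[g /= [gv hv]].
by rewrite -hv.
Qed.

Let fixv1 : fixv 1. Proof. by []. Qed.

Let fixvM x y : fixv x -> fixv y -> fixv (x * y).
Proof. by move=> xv yv; rewrite /fixv /= -[LHS]/(val x (val y v)) yv. Qed.

Let fixvV x : fixv x -> fixv x^-1.
Proof. by move=> xv; rewrite /fixv /= -{1}xv; exact: aut_funK. Qed.

Definition stab : closedSubgroup (subgroup_group G) :=
  ClosedSubgroup fixv_closed fixv1 fixvM fixvV.

(** Restricting to the stabilizer turns [pi_total] into a continuous homomorphism, as [image_stable]
    demands. *)
Definition pi_stab (x : subgroup_group stab) : aut d :=
  pi_total L v (val (val x)).

Lemma pi_stab_continuous : continuous pi_stab.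
Proof.
move=> x; apply: (@continuous_comp _ _ _
  (fun y : subgroup_group stab => val (val y)) (pi_total L v));
  last exact: pi_total_continuous.
apply: (@continuous_comp _ _ _ (set_val : subgroup_group stab -> subgroup_group G)
  (set_val : subgroup_group G -> aut d)); exact: initial_continuous.
Qed.

Lemma pi_stabM : {morph pi_stab : x y / x * y}.
Proof. by move=> x y; apply: pi_totalM; exact: (@set_valP _ stab). Qed.

HB.instance Definition _ := isMultiplicative.Build _ _ pi_stab pi_stabM.

(** The section of [A] at [v], cut down to [G]; nothing is lost when [G] is self-similar. *)
Definition section_csg (A : closedSubgroup (subgroup_group G)) :
    closedSubgroup (subgroup_group G) :=
  csgI_in G (csg_image pi_stab_continuous (csgI_in stab A)).

Lemma section_csgP A x : (section_csg A : set _) x <->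
  exists2 g, (A : set _) g /\ (val g : aut d) v = v & val x = pi_total L v (val g).
Proof.
split=> [[g Ag gx]|[g [Ag gv] xg]].
  by exists (val g); [split=> //; exact: (@set_valP _ stab g)|exact/esym].
have [y yg] := subgroup_group_val (gv : (stab : set _) g).
by exists y; [rewrite /= -[set_val y]/(val y) yg|rewrite -[set_val x]/(val x) xg -yg].
Qed.

Lemma section_csg_stable (Q : forall G : profiniteGroupType, closedSubgroup G -> Prop) :
    subgroup_stable Q -> image_stable Q ->
    section_group L v G = (G : set (aut d)) ->
  forall A, Q (subgroup_group G) A -> Q (subgroup_group G) (section_csg A).
Proof.
move=> Qa Qb Gv A QA.
have := Qb _ _ pi_stab pi_stab_continuous _ (Qa _ _ stab QA).
(* The image of the whole stabilizer is the section of [G] at [v], that is [G] by [Gv], so the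
   ambient group is again [G]. *)
rewrite (_ : csg_image _ (csgT _) = G) //.
apply: csg_eq; rewrite -[RHS]Gv section_groupE eqEsubset.
split=> [_ [x _ <-]|_ [h [Gh hv] <-]].
  by exists (val (val x)) => //; split;
    [exact: (@set_valP _ G)|exact: (@set_valP _ stab)].
have [g gh] := subgroup_group_val Gh.
have gv : (stab : set _) g by rewrite /= /fixv /= gh.
have [x xg] := subgroup_group_val gv.
by exists x => //; rewrite -gh -xg.
Qed.

End sections_in_subgroup.

(** * The self-similar closure as the limit of a chain *)

Section closure_from_chains.
Variable Q : forall G : profiniteGroupType, closedSubgroup G -> Prop.
Hypotheses (Qa : subgroup_stable Q) (Qb : image_stable Q)
  (Qc : compositum_stable Q).
(** A common consequence of (d) and of openness, so that one argument serves both cases; sequences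
    suffice since the tree has countably many vertices. *)
Hypothesis Qchain : forall (G : profiniteGroupType) (A : nat -> closedSubgroup G),
  (forall n, (A n : set G) `<=` A n.+1) -> (forall n, Q (A n)) ->
  forall M : closedSubgroup G,
    (M : set G) = closure (\bigcup_n (A n : set G)) -> Q M.
Context (d : nat) (L : path_data d) (G : closedSubgroup (aut d)).
Hypothesis fractalG : fractal L G.

Lemma self_similar_property_of_chains :
  self_similar_property L (Q (G := subgroup_group G)).
Proof.
move=> H HG QH.
pose A := saturation (fun v : seq 'I_d => section_csg L v) (csgI_in G H).
have AS n : (A n : set _) `<=` A n.+1 by exact: saturation_subS.
have [M ME] := closure_bigcup_csg AS.
have QM : Q M.
  apply: Qchain ME => //.
  apply: saturation_ind => // [B C|v B]; first exact: Qc.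
  exact: section_csg_stable.
suff -> : csgI_in G (self_similar_closure L G H) = M by [].
have ssG : self_similar L G by move=> v; rewrite fractalG.
have [ssK HK KG Kmin] := self_similar_closureP ssG HG.
apply: csg_eq; rewrite eqEsubset; split; last first.
  (* First inclusion: [K] is closed, contains [H] and is stable under sections, hence contains every
     [A n] and their limit. *)
  rewrite ME; set K := csgI_in _ _.
  suff AK n : (A n : set _) `<=` K.
    apply: (@subset_trans _ (closure (K : set _))); last exact: csg_closed.
    by apply: closureS => x [n _ /AK].
  apply: (saturation_ind (T := fun B => (B : set _) `<=` K)) => [B C|v B BK|x /HK//].
    exact: compositum_min.
  move=> x /section_csgP[g [/BK Kg gv] xg]; apply: (ssK v).
  by rewrite section_groupE -[set_val x]/(val x) xg; exists (val g).
(* Reverse inclusion: [M] is carried to a closed subgroup [N] of [aut d], where minimality of the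
   self-similar closure applies. *)
have cval : continuous (set_val : subgroup_group G -> aut d).
  exact: initial_continuous.
have vM : {morph (set_val : subgroup_group G -> aut d) : x y / x * y} by [].
pose f := HB.pack_for {multiplicative subgroup_group G -> aut d}
  (set_val : subgroup_group G -> aut d) (isMultiplicative.Build _ _ _ vM).
pose N := csg_image (cval : continuous f) M.
have NE x : (N : set _) (val x) <-> (M : set _) x.
  by split=> [[y My /val_inj <-]|Mx]; [|exists x].
suff KN : (self_similar_closure L G H : set (aut d)) `<=` N by move=> x /KN/NE.
apply: Kmin => [v|h Hh|_ [x _ <-]]; last exact: set_valP.
  rewrite section_groupE => _ [_ [[g Mg <-] gv] <-] /=.
  (* [C] is closed by continuity of [pi_total], so it suffices to test elements of the [A n]. *)
  pose C := (pi_total L v \o set_val : subgroup_group G -> aut d) @^-1` N.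
  suff /(_ _ Mg) : (M : set _) `<=` C by [].
  have cC : closed C.
    apply: preimage_closed; last exact: csg_closed.
    by move=> x _; apply: continuous_comp; [exact: cval|exact: pi_total_continuous].
  rewrite ME; apply: (@subset_trans _ (closure C)); last exact: cC.
  apply: closureS => x [n _ Ax].
  change ((N : set _) (pi_total L v (val x))).
  have [xv|xv] := pselect ((val x : aut d) v = v); last first.
    by rewrite pi_total_nfix //; exact: (csg1 N).
  have Gx : (G : set _) (pi_total L v (val x)).
    by apply: (ssG v); rewrite section_groupE; exists (val x) => //; split=> //; exact: set_valP.
  have [y yx] := subgroup_group_val Gx.
  rewrite -yx; apply/NE; rewrite ME; apply: subset_closure.
  (* At stage [m] the element [x] is already present and the code of [v] is below [m], so its
     section enters at stage [m.+1]. *)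
  pose m := maxn n (@pickle (seq 'I_d) v).+1.
  exists m.+1 => //; apply: (@saturation_op _ _ _ _ v); first exact: leq_maxr.
  apply/section_csgP; exists x => //; split=> //.
  exact: saturation_sub (leq_maxl _ _) _ Ax.
have [g gh] := subgroup_group_val (HG _ Hh).
rewrite -gh; apply/NE; rewrite ME; apply: subset_closure.
by exists 0%N; rewrite //= -[set_val g]/(val g) gh.
Qed.

End closure_from_chains.

(** * The two sources of closure under ascending sequences *)

Theorem proposition24
  (Q : forall G : profiniteGroupType, closedSubgroup G -> Prop)
  (Qa : subgroup_stable Q) (Qb : image_stable Q) (Qc : compositum_stable Q)
  (d : nat) (d_gt0 : (0 < d)%N) (L : path_data d)
  (G : closedSubgroup (aut d)) (fractalG : fractal L G) :
  (chain_stable Q -> self_similar_property L (Q (subgroup_group G))) /\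
  (forces_open Q -> self_similar_property L (Q (subgroup_group G))).
Proof.
split=> [Qd|Qo]; apply: self_similar_property_of_chains => // P A AS QA M ME.
  exact: (Qd P _ nat 0%N A (ascending_subset AS) QA M ME).
have [n An] := open_ascending_stationary AS (fun n => Qo _ _ (QA n)).
by rewrite (_ : M = A n) //; apply: csg_eq; rewrite ME An.
Qed.
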